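(* Let $\mathscr{C}$ be a finitely complete category endowed with a Grothendieck topology $J$, let $C$ be an object of $\mathscr{C}$, let $A$ be a sieve on $C$ and let $p:1\to C$ be a point of $C$. Then $p$ lies in the closure of $A$ if and only if there is a filter $\mathscr{G}$ on $\mathscr{C}$ such that $A\in\mathscr{G}(C)$ and $\mathscr{G}(C)$ converges to $p$.
   Context: A sieve on an object $C$ is a family $S$ of morphisms of $\mathscr{C}$ with codomain $C$ such that $f\in S$ implies $f\circ g\in S$ whenever the composite is defined; sieves on $C$ are ordered by inclusion. $J(C)$ denotes the collection of covering sieves on $C$ for $J$. A filter on $\mathscr{C}$ is a function $\mathfrak{F}$ assigning to each object $C$ of $\mathscr{C}$ a collection $\mathfrak{F}(C)$ of sieves on $C$ such that: (F1) if $S\in\mathfrak{F}(C)$ and $R$ is a sieve on $C$ with $S\subseteq R$, then $R\in\mathfrak{F}(C)$; (F2) every finite intersection of sieves of $\mathfrak{F}(C)$ belongs to $\mathfrak{F}(C)$; (F3) the empty sieve is not in $\mathfrak{F}(C)$. A point of $C$ is a morphism $p:1\to C$, where $1$ is a terminal object. A $\mathfrak{G}$-neighborhood of $p$ is a sieve $V\in J(C)$ for which there exist a morphism $\phi:D\to C$ in $V$ and a point $q:1\to D$ with $\phi\circ q=p$. A cover-neighborhood of $p$ is a sieve on $C$ that contains some $\mathfrak{G}$-neighborhood of $p$; $\mathscr{N}_p(C)$ is the collection of all cover-neighborhoods of $p$. For a filter $\mathscr{G}$, $\mathscr{G}(C)$ converges to $p$ if $\mathscr{N}_p(C)\subseteq\mathscr{G}(C)$.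 The closure of a sieve $A$ on $C$ is the collection of all points $p$ of $C$ such that every cover-neighborhood of $p$ meets $A$ (two sieves on $C$ meet if their intersection is not the empty sieve). *)

(* Defs.v *)
From mathcomp Require Import all_boot.
From mathcomp Require Import boolp classical_sets cardinality.

Set Implicit Arguments.
Unset Strict Implicit.
Unset Printing Implicit Defensive.

Local Open Scope classical_set_scope.

Declare Scope cat_scope.
Local Open Scope cat_scope.

Reserved Notation "f \oc g" (at level 50, left associativity).

Record category := Category {
  obj :> Type;
  hom : obj -> obj -> Type;
  idm : forall X, hom X X;
  compm : forall X Y Z, hom Y Z -> hom X Y -> hom X Z;
  compm1 : forall X Y (f : hom X Y), compm f (idm X) = f;
  comp1m : forall X Y (f : hom X Y), compm (idm Y) f = f;
  compmA : forall W X Y Z (f : hom Y Z) (g : hom X Y) (h : hom W X),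
    compm f (compm g h) = compm (compm f g) h }.

Arguments idm {c} X.
Notation "f \oc g" := (compm f g) : cat_scope.

Record functor (I C : category) := Functor {
  fobj :> I -> C;
  fmap : forall i j, hom i j -> hom (fobj i) (fobj j);
  fmap1 : forall i, fmap (idm i) = idm (fobj i);
  fmapM : forall i j k (u : hom j k) (v : hom i j),
    fmap (u \oc v) = fmap u \oc fmap v }.

Definition is_cone (I C : category) (F : functor I C) (L : C)
    (l : forall i, hom L (F i)) : Prop :=
  forall i j (u : hom i j), fmap F u \oc l i = l j.

Definition is_limit (I C : category) (F : functor I C) (L : C)
    (l : forall i, hom L (F i)) : Prop :=
  is_cone l /\
  forall (M : C) (m : forall i, hom M (F i)), is_cone m ->
    exists! h : hom M L, forall i, l i \oc h = m i.

Definition finite_category (I : category) : Prop :=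
  finite_set [set: I] /\ forall i j : I, finite_set [set: hom i j].

Definition finitely_complete (C : category) : Prop :=
  forall (I : category), finite_category I ->
  forall F : functor I C, exists (L : C) (l : forall i, hom L (F i)),
    is_limit l.

Definition terminal (C : category) (T : C) : Prop :=
  forall X : C, exists! f : hom X T, True.

Section Sieves.
Variable C : category.
Implicit Types X Y : C.

Record sieve X := Sieve {
  arrows :> forall D : C, set (hom D X);
  sieve_comp : forall D E (f : hom D X) (g : hom E D),
    arrows f -> arrows (f \oc g) }.

Definition sieve_sub X (S R : sieve X) : Prop := forall D : C, S D `<=` R D.

Lemma sieve_ext X (S R : sieve X) : sieve_sub S R -> sieve_sub R S -> S = R.
Proof.
case: S R => [S cS] [R cR] SR RS; suff eqSR : S = R.
  by case: R / eqSR cR {SR RS} => cR; congr Sieve; apply: Prop_irrelevance.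
by apply: functional_extensionality_dep => D; apply/seteqP; split;
  [exact: SR | exact: RS].
Qed.

Definition max_sieve X : sieve X :=
  @Sieve X (fun D => [set: hom D X]) (fun _ _ _ _ _ => I).

Definition empty_sieve X : sieve X :=
  @Sieve X (fun D => set0) (fun _ _ _ _ nof => nof).

Fact sieveI_comp X (S R : sieve X) D E (f : hom D X) (g : hom E D) :
  (S D `&` R D) f -> (S E `&` R E) (f \oc g).
Proof. by move=> [Sf Rf]; split; apply: sieve_comp. Qed.

Definition sieveI X (S R : sieve X) : sieve X :=
  @Sieve X (fun D => S D `&` R D) (@sieveI_comp X S R).

Fact sieve_bigI_comp X (K : set (sieve X)) D E (f : hom D X) (g : hom E D) :
  (\bigcap_(S in K) S D) f -> (\bigcap_(S in K) S E) (f \oc g).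
Proof. by move=> Kf S KS; apply/sieve_comp/Kf. Qed.

Definition sieve_bigI X (K : set (sieve X)) : sieve X :=
  @Sieve X (fun D => \bigcap_(S in K) S D) (@sieve_bigI_comp X K).

Fact sieve_pullback_comp X Y (h : hom Y X) (S : sieve X) D E
    (f : hom D Y) (g : hom E D) :
  S D (h \oc f) -> S E (h \oc (f \oc g)).
Proof. by rewrite compmA; apply: sieve_comp. Qed.

Definition sieve_pullback X Y (h : hom Y X) (S : sieve X) : sieve Y :=
  @Sieve Y (fun D => [set f | S D (h \oc f)]) (@sieve_pullback_comp X Y h S).

Definition meets X (S R : sieve X) : Prop := sieveI S R <> empty_sieve X.

Record grothendieck_topology := GrothendieckTopology {
  covering :> forall X, set (sieve X);
  covering_max : forall X, covering (max_sieve X);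
  covering_pullback : forall X Y (h : hom Y X) (S : sieve X),
    covering S -> covering (sieve_pullback h S);
  covering_trans : forall X (S R : sieve X), covering S ->
    (forall Y (h : hom Y X), S Y h -> covering (sieve_pullback h R)) ->
    covering R }.

Record sieve_filter := SieveFilter {
  filter_sieves :> forall X, set (sieve X);
  filter_up : forall X (S R : sieve X),
    filter_sieves S -> sieve_sub S R -> filter_sieves R;
  (* With K empty, this puts the maximal sieve in every filter. *)
  filter_bigI : forall X (K : set (sieve X)),
    finite_set K -> K `<=` @filter_sieves X -> filter_sieves (sieve_bigI K);
  filter_not_empty : forall X, ~ filter_sieves (empty_sieve X) }.

Variables (J : grothendieck_topology) (one : C).

Definition is_neighborhood X (p : hom one X) (V : sieve X) : Prop :=
  J X V /\ exists (D : C) (phi : hom D X) (q : hom one D),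
    V D phi /\ phi \oc q = p.

Definition cover_neighborhoods X (p : hom one X) : set (sieve X) :=
  [set N | exists V : sieve X, is_neighborhood p V /\ sieve_sub V N].

Definition converges (G : sieve_filter) X (p : hom one X) : Prop :=
  cover_neighborhoods p `<=` G X.

Definition sieve_closure X (A : sieve X) : set (hom one X) :=
  [set p | forall N : sieve X, cover_neighborhoods p N -> meets N A].

End Sieves.

Arguments max_sieve {C} X.
Arguments empty_sieve {C} X.

(* Main.v *)
(** The sieves on [X] that contain [V n A] for some neighborhood [V] of [p] are
    closed under finite intersections, because a neighborhood of [p] is just a
    covering sieve to which [p] itself belongs.  When [p] is in the closure of
    [A] they form a proper filter on [X]; giving every other object the filter
    consisting of its maximal sieve only turns this into a filter on the whole
    category, since no compatibility between different objects is required. *)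
Require Import Defs.
From mathcomp Require Import all_boot.
From mathcomp Require Import boolp classical_sets cardinality.

Set Implicit Arguments.
Unset Strict Implicit.
Unset Printing Implicit Defensive.

Local Open Scope classical_set_scope.
Local Open Scope cat_scope.

Section SieveFilters.
Variable C : category.
Implicit Types X Y : C.

Lemma max_sieve_neq_empty X : max_sieve X <> empty_sieve X.
Proof.
by move=> max_empty; have : empty_sieve X X (idm X) by rewrite -max_empty.
Qed.

Lemma filter_meets (G : sieve_filter C) X (S R : sieve X) :
  G X S -> G X R -> Defs.meets S R.
Proof.
move=> GS GR SR0; apply: (@filter_not_empty _ G X); rewrite -SR0.
apply: (@filter_up _ G X (sieve_bigI [set S; R])).
  by apply: filter_bigI => // T [] ->.
by move=> D f SRf; split; apply: SRf; [left | right].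
Qed.

(** Filters on a single object, with finite intersections split into the empty and the binary case,
    which are easier to check. *)
Record sieve_filter_on X (F : set (sieve X)) : Prop := SieveFilterOn {
  filter_on_max : F (max_sieve X);
  filter_on_up : forall S R, F S -> sieve_sub S R -> F R;
  filter_onI : forall S R, F S -> F R -> F (sieveI S R);
  filter_on_not_empty : ~ F (empty_sieve X) }.

Lemma filter_on_bigI X (F : set (sieve X)) (K : set (sieve X)) :
  sieve_filter_on F -> finite_set K -> K `<=` F -> F (sieve_bigI K).
Proof.
move=> filterF.
(* Classical equality on sieves lets the finite [K] be listed, for an induction on the list. *)
move=> /(@finite_seqP {classic (sieve X)}) [s ->] {K}.
elim: s => [_|S s IHs sF].
  by apply: (filter_on_up filterF (filter_on_max filterF)) => D f _ T.
apply: (@filter_on_up _ _ filterF (sieveI S (sieve_bigI [set` s]))).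
  apply: (filter_onI filterF); first by apply: sF; rewrite /= mem_head.
  by apply: IHs => T sT; apply: sF; rewrite /= in_cons [T \in s]sT orbT.
move=> D f [Sf sf] T; rewrite /= in_cons => /orP[/eqP -> //|sT].
exact: sf.
Qed.

Lemma trivial_filter_on X : sieve_filter_on [set max_sieve X].
Proof.
split=> // [S R -> maxR|S R -> ->|/esym]; last exact: max_sieve_neq_empty.
  exact: sieve_ext.
by apply: sieve_ext.
Qed.

Lemma filter_of_family (F : forall Y, set (sieve Y)) :
  (forall Y, sieve_filter_on (@F Y)) ->
  exists G : sieve_filter C, forall Y, G Y = @F Y.
Proof.
move=> filterF.
have Fup Y := @filter_on_up _ _ (filterF Y).
have FbigI Y K := @filter_on_bigI _ _ K (filterF Y).
by exists (SieveFilter Fup FbigI (fun Y => filter_on_not_empty (filterF Y))).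
Qed.

Lemma extend_filter_on X (F : set (sieve X)) :
  sieve_filter_on F -> exists G : sieve_filter C, G X = F.
Proof.
move=> filterF.
(* Equality of objects is decided classically and [F] is transported along it; proof irrelevance
   makes the transport at [X] itself trivial. *)
pose E Y : set (sieve Y) := match pselect (X = Y) with
  | left XY => eq_rect X (fun Z => set (sieve Z)) F Y XY
  | right _ => [set max_sieve Y]
  end.
have [Y|G GE] := @filter_of_family E.
  rewrite /E; case: pselect => [XY|_]; last exact: trivial_filter_on.
  by case: Y / XY.
exists G; rewrite GE /E; case: pselect => // XX.
by rewrite (Prop_irrelevance XX erefl).
Qed.

Variables (J : grothendieck_topology C) (one : C).

(** Along any [h] in [S], the sieves [sieveI S R] and [R] have the same pullback, which covers by
    stability; transitivity concludes. *)
Lemma coveringI X (S R : sieve X) : J X S -> J X R -> J X (sieveI S R).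
Proof.
move=> JS JR; apply: (covering_trans JS) => Y h Sh.
suff -> : sieve_pullback h (sieveI S R) = sieve_pullback h R.
  exact: covering_pullback.
apply: sieve_ext => D f; first by case.
by move=> Rf; split=> //; apply: sieve_comp.
Qed.

(** Sieves absorb precomposition, so [phi \oc q = p] lies in [V]; conversely, take [phi = p] and [q]
    the identity. *)
Lemma is_neighborhoodE X (p : hom one X) (V : sieve X) :
  is_neighborhood J p V <-> J X V /\ V one p.
Proof.
split=> [[JV [D [phi [q [Vphi <-]]]]]|[JV Vp]].
  by split=> //; apply: sieve_comp.
by split=> //; exists one, p, (idm one); rewrite compm1.
Qed.

Lemma closure_filter_on X (A : sieve X) (p : hom one X) :
  sieve_closure J A p ->
  sieve_filter_on
    [set S | exists2 V, is_neighborhood J p V & sieve_sub (sieveI V A) S].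
Proof.
move=> clA; split.
- exists (max_sieve X) => //; apply/is_neighborhoodE.
  by split=> //; apply: covering_max.
- by move=> S R [V nV VS] SR; exists V => // D f /VS /SR.
- move=> S R [V /is_neighborhoodE[JV Vp] VS] [W /is_neighborhoodE[JW Wp] WR].
  exists (sieveI V W).
    by apply/is_neighborhoodE; split; [exact: coveringI | split].
  by move=> D f [[Vf Wf] Af]; split; [apply: VS | apply: WR]; split.
(* [V] is itself a cover-neighborhood of [p], so it must meet [A]. *)
- move=> [V nV VA0]; have : Defs.meets V A by apply: clA; exists V; split=> // D f.
  by case; apply: sieve_ext.
Qed.

End SieveFilters.

Theorem theorem4p6 (C : category) (C_complete : finitely_complete C)
    (J : grothendieck_topology C)
    (one : C) (one_terminal : terminal one)
    (X : C) (A : sieve X) (p : hom one X) :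
  sieve_closure J A p <->
  exists G : sieve_filter C, G X A /\ converges J G p.
Proof.
split=> [clA|[G [GA Gp]] N nN]; last exact: filter_meets (Gp N nN) GA.
have [G GX] := extend_filter_on (closure_filter_on clA).
exists G; rewrite /converges GX; split.
  (* The largest neighborhood of [p] witnesses that [A] is in the filter. *)
  exists (max_sieve X); last by move=> D f [].
  by apply/is_neighborhoodE; split=> //; apply: covering_max.
by move=> N [V [nV VN]]; exists V => // D f [Vf _]; apply: VN.
Qed.
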